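(* Let $G$ be a group and $N$ a normal subgroup of $G$. Then the following two conditions are equivalent. (i) $\mathrm{scl}_G$ and $\mathrm{scl}_{G,N}$ are bi-Lipschitz equivalent on $[G,N]$; namely, there exists $C\in\mathbb{R}_{\ge 1}$ such that for every $y\in[G,N]$, $$\mathrm{scl}_{G,N}(y)\le C\cdot \mathrm{scl}_G(y).$$ (ii) $\mathrm{W}(G,N)=0$.
   Context: Mixed scl: $[G,N]$ is the subgroup of $G$ generated by the set $\mathcal{S}_{G,N}=\{[g,x]=gxg^{-1}x^{-1} : g\in G, x\in N\}$. The mixed commutator length $\mathrm{cl}_{G,N}:[G,N]\to\mathbb{Z}_{\ge0}$ is the word length with respect to $\mathcal{S}_{G,N}$: $\mathrm{cl}_{G,N}(y)$ is the minimal $n\ge 0$ such that $y$ is a product of $n$ elements of $\mathcal{S}_{G,N}$. The stable mixed commutator length is $\mathrm{scl}_{G,N}(y)=\lim_{k\to\infty}\mathrm{cl}_{G,N}(y^k)/k$ for $y\in[G,N]$. Put $\mathrm{scl}_G=\mathrm{scl}_{G,G}$, defined on $[G,G]\supseteq[G,N]$. (The inequality $\mathrm{scl}_G\le\mathrm{scl}_{G,N}$ always holds on $[G,N]$.) Quasimorphisms: for a group $H$ and $f:H\to\mathbb{R}$, the defect is $D_H(f)=\sup\{|f(h_1h_2)-f(h_1)-f(h_2)| : h_1,h_2\in H\}$; $f$ is a quasimorphism if $D_H(f)<\infty$, and homogeneous if its restriction to every cyclic subgroup is a homomorphism. $\mathrm{Q}(H)$ is the real vector space of homogeneous quasimorphisms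 on $H$, and $\mathrm{H}^1(H)=\mathrm{Hom}(H,\mathbb{R})\subseteq \mathrm{Q}(H)$. For $N$ normal in $G$, $\mathrm{Q}(N)^G=\{\mu\in\mathrm{Q}(N) : \mu(gxg^{-1})=\mu(x)\ \forall g\in G, x\in N\}$ and $\mathrm{H}^1(N)^G=\mathrm{H}^1(N)\cap\mathrm{Q}(N)^G$. Restriction to $N$ gives a linear map $i^*:\mathrm{Q}(G)\to\mathrm{Q}(N)^G$, $\phi\mapsto\phi|_N$. Define the quotient real vector space $$\mathrm{W}(G,N)=\mathrm{Q}(N)^G/\bigl(\mathrm{H}^1(N)^G+i^*\mathrm{Q}(G)\bigr).$$ *)

(* Defs.v *)
From HB Require Import structures.
From mathcomp Require Import all_boot all_order all_algebra.
From mathcomp Require Import all_classical all_reals.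
From mathcomp Require Import ereal topology normedtype sequences ring.
Set Implicit Arguments.
Unset Strict Implicit.
Unset Printing Implicit Defensive.
Import Order.TTheory GRing.Theory Num.Theory.
Import numFieldNormedType.Exports.
Local Open Scope classical_set_scope.
Local Open Scope ring_scope.

(* Groups are [groupType]s, not necessarily finite; a subgroup of G is a
   [groupClosed G], i.e. a predicate on G containing 1 and stable under
   products and inverses. *)

Definition is_normal (G : groupType) (N : groupClosed G) : Prop :=
  forall g x : G, x \in N -> (g * x * g^-1)%g \in N.

Definition generated (G : groupType) (A : set G) : set G :=
  [set y | forall K : groupClosed G, A `<=` [set` K] -> y \in K].

(* The convention is [g, x] = g x g^-1 x^-1, while the library's [~ g, x] is
   g^-1 x^-1 g x. *)
Definition mixed_commutators (G : groupType) (N : {pred G}) : set G :=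
  [set y | exists g x : G, x \in N /\ y = (g * x * g^-1 * x^-1)%g].

Definition mixed_comm_subgroup (G : groupType) (N : {pred G}) : set G :=
  generated (mixed_commutators N).

Definition is_mixed_product (G : groupType) (N : {pred G}) (y : G) (n : nat) :=
  exists s : seq G, [/\ size s = n,
    forall z, z \in s -> mixed_commutators N z & y = (\prod_(z <- s) z)%g].

(* The minimal n such that y is a product of n elements of
   [mixed_commutators N]; it is 0 (and meaningless) when there is no such n.
   The set of mixed commutators is stable under inverses, so that there is one
   for each y in [G, N]. *)
Definition mixed_cl (G : groupType) (N : {pred G}) (y : G) : nat :=
  xget 0%N [set n | is_mixed_product N y n /\
                    forall m, is_mixed_product N y m -> (n <= m)%N].

(* For y in [G, N] the sequence k |-> cl (y ^ k) is subadditive, hence the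
   limit exists. *)
Definition mixed_scl (R : realType) (G : groupType) (N : {pred G}) (y : G) : R :=
  limn (fun k : nat => (mixed_cl N (y ^+ k)%g)%:R / k%:R : R).

Definition scl (R : realType) (G : groupType) (y : G) : R :=
  mixed_scl R (fun _ : G => true) y.

Section Quasimorphisms.
Variables (R : realType) (H : groupType).
Implicit Types f : H -> R^o.

Definition defect f : \bar R :=
  ereal_sup [set `|f (h.1 * h.2)%g - f h.1 - f h.2|%:E | h in [set: H * H]].

Definition quasimorphism f : Prop := (defect f < +oo)%E.

Definition homogeneous f : Prop :=
  forall h x y, generated [set h] x -> generated [set h] y ->
    f (x * y)%g = f x + f y.

(* Q(H) *)
Definition homog_qm : {pred H -> R^o} :=
  fun f => `[< quasimorphism f /\ homogeneous f >].

(* H^1(H) = Hom(H, R) *)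
Definition real_hom : {pred H -> R^o} :=
  fun f => `[< {morph f : x y / (x * y)%g >-> x + y} >].

Lemma quasimorphismP f : quasimorphism f <->
  exists D : R, forall x y, `|f (x * y)%g - f x - f y| <= D.
Proof.
split=> [qf|[D fD]].
  have ub x y : (`|f (x * y)%g - f x - f y|%:E <= defect f)%E.
    by apply: ereal_sup_ubound; exists (x, y).
  move: qf ub; rewrite /quasimorphism.
  case: (defect f) => [D _ ub|//|_ ub]; last by have := ub 1%g 1%g.
  by exists D => x y; rewrite -lee_fin.
apply: (@le_lt_trans _ _ D%:E); last by rewrite ltry.
by apply: ge_ereal_sup => _ [[x y] _ <-]; rewrite lee_fin.
Qed.

Lemma homog_qm_submod : submod_closed homog_qm.
Proof.
split=> [|a f g].
  apply/asboolP; split; last by move=> h x y _ _; rewrite /= addr0.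
  by apply/quasimorphismP; exists 0 => x y; rewrite !subr0 normr0.
move=> /asboolP[/quasimorphismP[D fD] hf] /asboolP[/quasimorphismP[E gE] hg].
apply/asboolP; split; last first.
  move=> h x y hx hy; rewrite !addrfctE !scalrfctE (hf h) // (hg h) //.
  by rewrite scalerDr addrACA.
apply/quasimorphismP; exists (`|a| * D + E) => x y.
rewrite [X in `|X|](_ : _ = a * (f (x * y)%g - f x - f y)
                            + (g (x * y)%g - g x - g y)); last first.
  rewrite !addrfctE !scalrfctE /GRing.scale /=; ring.
by rewrite (le_trans (ler_normD _ _)) // lerD // normrM ler_wpM2l.
Qed.

HB.instance Definition _ :=
  GRing.isSubmodClosed.Build R (H -> R^o) homog_qm homog_qm_submod.

Definition HomogQM : Type := {f : H -> R^o | f \in homog_qm}.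
HB.instance Definition _ := SubType.on HomogQM.
HB.instance Definition _ := Choice.on HomogQM.
HB.instance Definition _ := [SubChoice_isSubLmodule of HomogQM by <:].

End Quasimorphisms.

Section SubmodQuotient.
Variables (K : pzRingType) (V : lmodType K) (U : zmodClosed V).
Hypothesis U_scale : scaler_closed U.
Local Open Scope quotient_scope.

(* The library provides the quotient by an additive subgroup. *)
Definition submod_quot & scaler_closed U : Type := Quotient.quot U.
Local Notation Q := (submod_quot U_scale).
HB.instance Definition _ := GRing.Zmodule.on Q.
HB.instance Definition _ := ZmodQuotient.on Q.

Definition quot_scale (a : K) (w : Q) : Q :=
  \pi_Q (a *: repr w).

Lemma pi_quot_scale a v :
  quot_scale a (\pi_Q v) = \pi_Q (a *: v).
Proof.
have E : repr (\pi_Q v) - v \in U.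
  by rewrite Quotient.idealrBE; apply/eqP; apply: (reprK (\pi_Q v)).
apply/eqP; rewrite /quot_scale -Quotient.idealrBE -scalerBr.
exact: (U_scale a E).
Qed.

Lemma quot_scalerA a b w :
  quot_scale a (quot_scale b w) = quot_scale (a * b) w.
Proof. by rewrite -[w]reprK (pi_quot_scale b) !pi_quot_scale scalerA. Qed.

Lemma quot_scale1r : left_id 1 quot_scale.
Proof. by move=> w; rewrite -[w]reprK pi_quot_scale scale1r. Qed.

Lemma quot_scalerDr : right_distributive quot_scale +%R.
Proof.
move=> a u v; rewrite -[u]reprK -[v]reprK -raddfD !pi_quot_scale scalerDr.
exact: raddfD.
Qed.

Lemma quot_scalerDl w : {morph quot_scale^~ w : a b / a + b}.
Proof.
by move=> a b /=; rewrite -[w]reprK !pi_quot_scale scalerDl raddfD.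
Qed.

HB.instance Definition _ := GRing.Zmodule_isLmodule.Build K Q
  quot_scalerA quot_scale1r quot_scalerDr quot_scalerDl.

End SubmodQuotient.

Section MixedSpace.
Variables (R : realType) (G : groupType) (N : groupClosed G).

Definition subgroup_of : Type := {x : G | x \in N}.
HB.instance Definition _ := SubType.on subgroup_of.
HB.instance Definition _ := Choice.on subgroup_of.

Lemma subgroup_of_closed : group_closed (fun x : G => x \in N).
Proof. by split=> [|x y]; [apply: gpred1 | apply: gpredF]. Qed.

HB.instance Definition _ :=
  SubChoice_isSubGroup.Build G (fun x : G => x \in N) subgroup_of
    subgroup_of_closed.

(* When N is normal, the hypothesis Ngx always holds. *)
Definition conj_invariant (mu : subgroup_of -> R^o) : Prop :=
  forall (g : G) (x : subgroup_of) (Ngx : (g * val x * g^-1)%g \in N),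
    mu (exist _ (g * val x * g^-1)%g Ngx) = mu x.

(* Q(N)^G *)
Definition inv_homog_qm : {pred subgroup_of -> R^o} :=
  fun mu => (mu \in @homog_qm R subgroup_of) && `[< conj_invariant mu >].

Lemma inv_homog_qm_submod : submod_closed inv_homog_qm.
Proof.
split=> [|a f g /andP[Qf /asboolP If] /andP[Qg /asboolP Ig]].
  by apply/andP; split; [apply: rpred0 | apply/asboolP].
apply/andP; split; first by rewrite rpredD // rpredZ.
by apply/asboolP => u x Nux; rewrite !addrfctE !scalrfctE If Ig.
Qed.

HB.instance Definition _ :=
  GRing.isSubmodClosed.Build R (subgroup_of -> R^o) inv_homog_qm
    inv_homog_qm_submod.

Definition InvHomogQM : Type :=
  {mu : subgroup_of -> R^o | mu \in inv_homog_qm}.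
HB.instance Definition _ := SubType.on InvHomogQM.
HB.instance Definition _ := Choice.on InvHomogQM.
HB.instance Definition _ := [SubChoice_isSubLmodule of InvHomogQM by <:].

(* H^1(N)^G, as a subspace of Q(N)^G *)
Definition inv_real_hom (mu : InvHomogQM) : Prop :=
  val mu \in @real_hom R subgroup_of.

(* i^* Q(G), as a subspace of Q(N)^G; homogeneous quasimorphisms on G are
   invariant under conjugation, so that every phi in Q(G) restricts to such a
   rho. *)
Definition extendable (rho : InvHomogQM) : Prop :=
  exists phi : HomogQM R G, forall x : subgroup_of, val rho x = val phi (val x).

(* H^1(N)^G + i^* Q(G) *)
Definition trivial_qm : {pred InvHomogQM} :=
  fun mu => `[< exists nu rho : InvHomogQM,
    [/\ inv_real_hom nu, extendable rho & mu = nu + rho] >].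

Lemma trivial_qm_submod : submod_closed trivial_qm.
Proof.
split=> [|a f g].
  apply/asboolP; exists 0, 0; split; last by rewrite addr0.
    by apply/asboolP => x y; rewrite /= addr0.
  by exists 0.
move=> /asboolP[n1 [r1 [/asboolP h1 [p1 e1] ->]]].
move=> /asboolP[n2 [r2 [/asboolP h2 [p2 e2] ->]]].
apply/asboolP; exists (a *: n1 + n2), (a *: r1 + r2); split.
- apply/asboolP => x y.
  by rewrite linearP /= !addrfctE !scalrfctE h1 h2 scalerDr addrACA.
- exists (a *: p1 + p2) => x.
  by rewrite !linearP /= !addrfctE !scalrfctE e1 e2.
- by rewrite scalerDr addrACA.
Qed.

HB.instance Definition _ :=
  GRing.isSubmodClosed.Build R InvHomogQM trivial_qm trivial_qm_submod.

Lemma trivial_qm_scale : scaler_closed trivial_qm.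
Proof. by move=> a f; apply: rpredZ. Qed.

(* W(G, N) *)
Definition W : Type := submod_quot trivial_qm_scale.
HB.instance Definition _ := GRing.Lmodule.on W.

End MixedSpace.

(* Main.v *)
(* By a Hahn-Banach argument on the group of sequences [n |-> z_n] in N, an
   asymptotic form of the mixed commutator length dominates a homomorphism [f]
   with prescribed values; commutators of such sequences have bounded length, so
   no passage to an abelian quotient is needed.  Then [mu x = f (n |-> x^n)] is a
   G-invariant homogeneous quasimorphism on N, because [(x y)^n y^-n x^-n] has
   length at most n and [(g x g^-1)^n x^-n] length at most 1.

   If scl_{G,N} <= C scl_G and mu is in Q(N)^G, then mu on [G, N] is bounded by a
   multiple of scl_G, so the same extension for the pair (G, G) gives phi in Q(G)
   that agrees with mu on [G, N].  Then mu - phi vanishes on [N, N], hence it is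
   a homomorphism, and mu is trivial in W(G, N).

   Conversely, if no C exists, take y_n in [G, N] with
   scl_{G,N}(y_n) > 9^n scl_G(y_n) and mu_n with mu_n(y_n) = scl_{G,N}(y_n) and
   |mu_n| <= cl_{G,N} (the sharp case of Bavard duality).  A gliding hump
   sum_n +-3^-n mu_n produces mu in Q(N)^G with |mu(y_n)| not O(scl_G(y_n)),
   whereas a trivial mu agrees on [G, N] with some phi in Q(G), for which
   |phi| <= 2 D(phi) scl_G. *)
Require Import Defs.
From HB Require Import structures.
From mathcomp Require Import all_boot all_order all_algebra.
From mathcomp Require Import all_classical all_reals.
From mathcomp Require Import ereal topology normedtype sequences ring lra.
Import Order.TTheory GRing.Theory Num.Theory.
Import numFieldNormedType.Exports.
Local Open Scope classical_set_scope.
Local Open Scope ring_scope.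

Set Implicit Arguments.
Unset Strict Implicit.
Unset Printing Implicit Defensive.

Lemma expg_conj (T : groupType) (g x : T) n :
  ((g * x * g^-1) ^+ n = g * x ^+ n * g^-1)%g.
Proof.
elim: n => [|n IHn]; first by rewrite !expg0 mulg1 mulgV.
by rewrite !expgS IHn !mulgA mulgVK.
Qed.

(** * Hahn-Banach for sublinear bounds on a group that need not be abelian *)

Section DominatedHom.
Variables (R : realType) (T : groupType).
Implicit Types (x y a : T) (r s t : R) (P Q : set (T * R)).

(* [P (x, r)] is to be read as "p x <= r" for a sublinear function [p] that
   need not be finite everywhere. *)
Record sublinear P : Prop := Sublinear {
  sublinear1 : P (1%g, 0);
  sublinearM : forall x y r s, P (x, r) -> P (y, s) -> P ((x * y)%g, r + s);
  sublinearR : forall x y, P ((x * y * x^-1 * y^-1)%g, 0);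
  sublinearV : forall x r, P (x, r) -> exists s, P ((x^-1)%g, s);
  sublinear_ge0 : forall r, P (1%g, r) -> 0 <= r }.

Lemma sublinearX P x r n : sublinear P -> P (x, r) -> P ((x ^+ n)%g, n%:R * r).
Proof.
move=> sP Px; elim: n => [|n IHn]; first by rewrite mul0r; apply: sublinear1.
by rewrite expgS -natr1 mulrDl mul1r addrC; apply: sublinearM.
Qed.


(** A bound [r] on [a ^+ n] gives the upper bound [r / n] for [t], and a bound [s] on [a ^- m] the
    lower bound [- s / m]. The lower bounds lie below the upper ones because the powers cancel to
    [1], so their supremum serves as [t]. *)
Lemma sublinear_slope P a : sublinear P -> exists t, forall n r,
  (P ((a ^+ n)%g, r) -> n%:R * t <= r) /\ (P ((a ^- n)%g, r) -> - (n%:R * t) <= r).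
Proof.
move=> sP.
have cross n m r s : P ((a ^+ n)%g, r) -> P ((a ^- m)%g, s) ->
    - (n%:R * s) <= m%:R * r.
  move=> Pr Ps; rewrite -subr_ge0 opprK; apply: (sublinear_ge0 sP).
  have := sublinearM sP (sublinearX m sP Pr) (sublinearX n sP Ps).
  by rewrite expVgn -!expgnA mulnC mulgV.
pose L := [set q : R | exists n s, [/\ (0 < n)%N, P ((a ^- n)%g, s) & q = - s / n%:R]].
have [L0|L0] := pselect (L !=set0); last first.
  (* Without lower bounds there are no upper bounds either, by [sublinearV], and any [t] works. *)
  exists 0 => n r; rewrite mulr0 oppr0.
  case: n => [|n]; first by rewrite expg0 invg1; split; apply: sublinear_ge0.
  split=> Pr; case: L0; last by exists (- r / n.+1%:R), n.+1, r.
  have [s Ps] := sublinearV sP Pr.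
  by exists (- s / n.+1%:R), n.+1, s.
have ubL n r : (0 < n)%N -> P ((a ^+ n)%g, r) -> ubound L (r / n%:R).
  move=> n0 Pr _ [m [s [m0 Ps ->]]].
  rewrite ler_pdivlMr ?ltr0n // mulrAC ler_pdivrMr ?ltr0n // mulNr mulrC.
  by rewrite [r * _]mulrC; apply: cross.
have supL : has_sup L.
  split=> //; have [_ [n [s [n0 Ps _]]]] := L0.
  have [r] := sublinearV sP Ps; rewrite invgK => Pr.
  by exists (r / n%:R); apply: ubL.
exists (sup L) => -[|n] r.
  by rewrite expg0 invg1 mul0r oppr0; split; apply: sublinear_ge0.
split=> Pr.
  rewrite mulrC -ler_pdivlMr ?ltr0n //; apply: ge_sup => //.
  exact: ubL.
rewrite lerNl mulrC -ler_pdivrMr ?ltr0n //; apply: ub_le_sup; first exact: supL.2.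
by exists n.+1, r.
Qed.

(** The one-dimensional extension step: [a] and its inverse are adjoined at costs [t] and [- t].
    [A i j] is the integer power of exponent [j - i], and the choice of [t] is what keeps the bounds
    at [1] nonnegative. *)
Lemma sublinear_extend P a : sublinear P -> exists t Q,
  [/\ sublinear Q, P `<=` Q, Q (a, t) & Q ((a^-1)%g, - t)].
Proof.
move=> sP; have [t tP] := sublinear_slope a sP.
pose A i j := (a ^+ j * a ^- i)%g.
have AM i j k l : A (i + k)%N (j + l)%N = (A i j * A k l)%g.
  rewrite /A expgnDr addnC expgnDr invgM !mulgA; congr (_ * _)%g.
  rewrite -!mulgA; congr (_ * _)%g.
  by apply: commuteV; apply: commute_sym; apply: commuteX2; apply: commute_refl.
have AV i j : (A i j)^-1%g = A j i by rewrite /A invgF.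
exists t, [set z | exists i j, P ((z.1 * A i j)%g, z.2 - (i%:R - j%:R) * t)].
split.
- split.
  + exists 0%N, 0%N; rewrite /A /= invg1 !mulg1 subrr mul0r subr0.
    exact: sublinear1.
  + move=> x y r s [i [j /= Pr]] [k [l /= Ps]]; exists (i + k)%N, (j + l)%N => /=.
    (* A commutator, of cost 0, moves [A i j] past [y]. *)
    have := sublinearM sP (sublinearM sP Pr (sublinearR sP (A i j)^-1%g y)) Ps.
    rewrite invgK !natrD AM; congr (P (_, _)); last by ring.
    by move: (A i j) (A k l) => u v; rewrite !mulgA mulgVK mulgK.
  + move=> x y; exists 0%N, 0%N; rewrite /A /= invg1 !mulg1 subrr mul0r subr0.
    exact: sublinearR.
  + move=> x r [i [j /= Pr]]; have [s Ps] := sublinearV sP Pr.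
    exists (s + (j%:R - i%:R) * t), j, i; rewrite /= addrK -AV.
    have := sublinearM sP (sublinearR sP (A i j) (x * A i j)^-1%g) Ps.
    by rewrite add0r mulgVK invgM !mulgA mulgV mul1g.
  + move=> r [i [j /=]]; rewrite mul1g /A.
    have [ij|/ltnW ij] := leqP i j.
      rewrite -expgnFr // => /(tP _ _).1.
      rewrite natrB //; lra.
    rewrite -invgF -expgnFr // => /(tP _ _).2.
    rewrite natrB //; lra.
- move=> [x r] Pr; exists 0%N, 0%N; rewrite /A /= invg1 !mulg1 subrr mul0r subr0.
  exact: Pr.
- exists 1%N, 0%N; rewrite /A /= mul1g mulgV subr0 mul1r subrr.
  exact: sublinear1.
- exists 0%N, 1%N; rewrite /A /= invg1 mulg1 mulVg sub0r mulN1r subrr.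
  exact: sublinear1.
Qed.

(** Zorn is applied to the sets [X] with [P]|[X] sublinear rather than to sublinear sets, so that
    the union of the empty chain qualifies. *)
Lemma sublinear_maximal P : sublinear P -> exists Q,
  [/\ sublinear Q, P `<=` Q & forall Q', sublinear Q' -> Q `<=` Q' -> Q' `<=` Q].
Proof.
move=> sP.
have [|A [sA maxA]] := @Zorn_bigcup _ (fun X => sublinear (P `|` X)).
  move=> F FsP Ftot.
  have common z z' : (P `|` \bigcup_(X in F) X) z -> (P `|` \bigcup_(X in F) X) z' ->
      exists Y, [/\ sublinear Y, Y `<=` P `|` \bigcup_(X in F) X, Y z & Y z'].
    have sub X : F X -> P `|` X `<=` P `|` \bigcup_(X in F) X.
      by move=> FX; apply: setUS; apply: bigcup_sup.
    move=> [Pz|[X FX Xz]] [Pz'|[X' FX' Xz']].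
    - by exists P; split=> //; apply: subsetUl.
    - by exists (P `|` X'); split; [exact: FsP | exact: sub | left | right].
    - by exists (P `|` X); split; [exact: FsP | exact: sub | right | left].
    - have [XX'|X'X] := Ftot _ _ FX FX'.
        exists (P `|` X'); split; [exact: FsP | exact: sub | | by right].
        by right; apply: XX'.
      exists (P `|` X); split; [exact: FsP | exact: sub | by right |].
      by right; apply: X'X.
  split.
  + by left; apply: sublinear1.
  + move=> x y r s /common xr /xr[Y [sY YF Yx Yy]].
    by apply: YF; apply: sublinearM.
  + by left; apply: sublinearR.
  + move=> x r xr; have [Y [sY YF Yx _]] := common _ _ xr xr.
    by have [s Ys] := sublinearV sY Yx; exists s; apply: YF.
  + move=> r r1; have [Y [sY _ Yr _]] := common _ _ r1 r1.
    exact: sublinear_ge0 Yr.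
exists (P `|` A); split; [exact: sA | exact: subsetUl |].
move=> Q sQ AQ; have [QA|QA] := pselect (Q `<=` A).
  by move=> z /QA; right.
case: (maxA Q).
  by split=> // z Az; apply: AQ; right.
by rewrite setUidr // => z Pz; apply: AQ; left.
Qed.

(** A maximal [Q] already contains some [(x, t)] and [(x^-1, - t)] for each [x], which makes [t] the
    least bound at [x]. Subadditivity at [x * y] and at its inverse gives the two inequalities for
    additivity. *)
Lemma dominated_hom P : sublinear P -> exists f : T -> R,
  {morph f : x y / (x * y)%g >-> x + y} /\ forall x r, P (x, r) -> f x <= r.
Proof.
move=> /sublinear_maximal[Q [sQ PQ maxQ]].
have /choice[f fQ] x : exists t, Q (x, t) /\ Q ((x^-1)%g, - t).
  have [t [Q' [sQ' QQ' Q't Q'Nt]]] := sublinear_extend x sQ.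
  by exists t; split; apply: (maxQ Q').
have leQ x r : Q (x, r) -> f x <= r.
  move=> Qr; rewrite -subr_ge0; apply: (sublinear_ge0 sQ).
  by rewrite -(mulgV x); apply: sublinearM => //; case: (fQ x).
exists f; split=> [x y|x r /PQ]; last exact: leQ.
apply: le_anti; apply/andP; split.
  by apply: leQ; apply: sublinearM => //; case: (fQ x) (fQ y) => ? ? [].
have [Qxy _] := fQ (x * y)%g; have [[_ Qx] [_ Qy]] := (fQ x, fQ y).
have := sublinearM sQ Qxy (sublinearM sQ Qy Qx).
rewrite -invgM mulgV => /(sublinear_ge0 sQ); lra.
Qed.

End DominatedHom.

(** * The group of sequences *)

Definition group_seq (T : groupType) : Type := nat -> T.

Section GroupSeq.
Variable T : groupType.
Implicit Types u v w : group_seq T.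

HB.instance Definition _ := gen_eqMixin (group_seq T).
HB.instance Definition _ := gen_choiceMixin (group_seq T).

Definition group_seq_mul u v : group_seq T := fun n => (u n * v n)%g.
Definition group_seq_one : group_seq T := fun=> 1%g.
Definition group_seq_inv u : group_seq T := fun n => (u n)^-1%g.

Lemma group_seq_mulA : associative group_seq_mul.
Proof. by move=> u v w; apply/funext => n; apply: mulgA. Qed.

Lemma group_seq_mul1 : left_id group_seq_one group_seq_mul.
Proof. by move=> u; apply/funext => n; apply: mul1g. Qed.

Lemma group_seq_mulV : left_inverse group_seq_one group_seq_inv group_seq_mul.
Proof. by move=> u; apply/funext => n; apply: mulVg. Qed.

Lemma group_seq_mulg1 : right_id group_seq_one group_seq_mul.
Proof. by move=> u; apply/funext => n; apply: mulg1. Qed.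

Lemma group_seq_mulgV : right_inverse group_seq_one group_seq_inv group_seq_mul.
Proof. by move=> u; apply/funext => n; apply: mulgV. Qed.

HB.instance Definition _ := isGroup.Build (group_seq T)
  group_seq_mulA group_seq_mul1 group_seq_mulg1 group_seq_mulV group_seq_mulgV.

Lemma group_seqV u n : (u^-1)%g n = (u n)^-1%g. Proof. by []. Qed.

Definition powers (x : T) : group_seq T := fun n => (x ^+ n)%g.

Lemma powersM x y : commute x y -> powers (x * y)%g = (powers x * powers y)%g.
Proof. by move=> xy; apply/funext => n; apply: expgMn. Qed.

End GroupSeq.

(** * Products of a given number of mixed commutators *)

Section MixedProduct.
Variables (G : groupType) (N : groupClosed G).
Hypothesis N_normal : is_normal N.
Implicit Types (x y g : G) (k l m : nat).

Lemma mixed_commutators_in z : mixed_commutators N z -> z \in N.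
Proof.
by move=> [g [x [Nx ->]]]; rewrite gpredM // ?N_normal // gpredV.
Qed.

Lemma mixed_product_in y k : is_mixed_product N y k -> y \in N.
Proof.
by move=> [s [_ cs ->]]; rewrite big_seq gpred_prod // => z /cs/mixed_commutators_in.
Qed.

Lemma mixed_product1 : is_mixed_product N 1%g 0.
Proof. by exists [::]; rewrite big_nil. Qed.

Lemma mixed_productM x y k l : is_mixed_product N x k ->
  is_mixed_product N y l -> is_mixed_product N (x * y)%g (k + l).
Proof.
move=> [s [sk cs ->]] [t [tl ct ->]]; exists (s ++ t); split.
- by rewrite size_cat sk tl.
- by move=> z; rewrite mem_cat => /orP[/cs|/ct].
- by rewrite big_cat.
Qed.

Lemma mixed_product_comm g x : x \in N ->
  is_mixed_product N (g * x * g^-1 * x^-1)%g 1.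
Proof.
move=> Nx; exists [:: (g * x * g^-1 * x^-1)%g]; split=> //.
  by move=> z; rewrite inE => /eqP ->; exists g, x.
by rewrite big_seq1.
Qed.

(** The inverse of [g, x] is [g^-1, g x g^-1]. *)
Lemma mixed_productV x k : is_mixed_product N x k -> is_mixed_product N x^-1%g k.
Proof.
move=> [s [<- cs ->]] {x k}; elim: s cs => [|z s IHs] cs.
  by rewrite big_nil invg1; apply: mixed_product1.
rewrite big_cons invgM /= -addn1; apply: mixed_productM.
  by apply: IHs => t ts; apply: cs; rewrite inE ts orbT.
have [|g [x [Nx ->]]] := cs z; first by rewrite inE eqxx.
have := mixed_product_comm g^-1%g (N_normal g Nx).
by rewrite !invgM !invgK !mulgA mulVg mul1g mulgVK.
Qed.

Lemma mixed_productX x k n :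
  is_mixed_product N x k -> is_mixed_product N (x ^+ n)%g (n * k).
Proof.
move=> xk; elim: n => [|n IHn]; first exact: mixed_product1.
by rewrite expgS mulSn; apply: mixed_productM.
Qed.

Lemma mixed_productJ g x k :
  is_mixed_product N x k -> is_mixed_product N (g * x * g^-1)%g k.
Proof.
move=> [s [<- cs ->]] {x k}; elim: s cs => [|z s IHs] cs.
  by rewrite big_nil mulg1 mulgV; apply: mixed_product1.
rewrite big_cons /= -add1n.
have -> (u v : G) : (g * (u * v) * g^-1 = (g * u * g^-1) * (g * v * g^-1))%g.
  by rewrite !mulgA mulgVK.
apply: mixed_productM; last first.
  by apply: IHs => t ts; apply: cs; rewrite inE ts orbT.
have [|h [x [Nx ->]]] := cs z; first by rewrite inE eqxx.
have := mixed_product_comm (g * h * g^-1)%g (N_normal g Nx).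
by rewrite !invgM !invgK !mulgA !mulgVK.
Qed.

(** The element for [n + 1] is the conjugate by [x * y] of the element for [n], times the conjugate
    by [x] of the single commutator [y, x^n]. *)
Lemma mixed_product_expgM x y n : x \in N -> y \in N ->
  is_mixed_product N ((x * y) ^+ n * y ^- n * x ^- n)%g n.
Proof.
move=> Nx Ny; elim: n => [|n IHn].
  by rewrite !expg0 !invg1 !mulg1; apply: mixed_product1.
have Nxn : (x ^+ n)%g \in N by apply: gpredXn.
have := mixed_productM (mixed_productJ (x * y)%g IHn)
  (mixed_productJ x (mixed_product_comm y Nxn)).
by rewrite addn1 !(@expgS _ _ n) !invgM !mulgA !mulgVK.
Qed.

End MixedProduct.

(** * Commuting elements and homogeneous functions *)

Definition centralizer (T : groupType) (x : T) : {pred T} :=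
  fun y => (x * y == y * x)%g.

Section Centralizer.
Variables (T : groupType) (x : T).

Lemma centralizerP y : reflect (commute x y) (y \in centralizer x).
Proof. exact: eqP. Qed.

Lemma centralizer1 : 1%g \in centralizer x.
Proof. by apply/centralizerP/commute1. Qed.

Lemma centralizerM : {in centralizer x &, forall y z, (y * z)%g \in centralizer x}.
Proof.
by move=> y z /centralizerP xy /centralizerP xz; apply/centralizerP/commuteM.
Qed.

Lemma centralizerV : {in centralizer x, forall y, (y^-1)%g \in centralizer x}.
Proof. by move=> y /centralizerP xy; apply/centralizerP/commuteV. Qed.

HB.instance Definition _ := isMulClosed.Build T (centralizer x) centralizerM.
HB.instance Definition _ := isMul1Closed.Build T (centralizer x) centralizer1.
HB.instance Definition _ := isInvClosed.Build T (centralizer x) centralizerV.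

End Centralizer.

Lemma generated_commute (T : groupType) (h x y : T) :
  generated [set h] x -> generated [set h] y -> commute x y.
Proof.
move=> hx hy; have /centralizerP xh : x \in centralizer h.
  by apply: hx => _ ->; apply/centralizerP/commute_refl.
by apply/centralizerP; apply: hy => _ ->; apply/centralizerP/commute_sym.
Qed.

Section Homogeneous.
Variables (R : realType) (T : groupType) (f : T -> R^o).

Lemma commute_homogeneous :
  (forall x y, commute x y -> f (x * y)%g = f x + f y) -> homogeneous f.
Proof. by move=> fM h x y hx hy; apply: fM; apply: generated_commute hx hy. Qed.

Hypothesis hf : homogeneous f.

Lemma homogeneous1 : f 1%g = 0.
Proof.
have g1 : generated [set 1%g : T] 1%g by move=> K _; apply: gpred1.
by apply: (addrI (f 1%g)); rewrite -(hf g1 g1) mulg1 addr0.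
Qed.

Lemma homogeneousX x n : f (x ^+ n)%g = n%:R * f x.
Proof.
have gx : generated [set x] x by move=> K; apply.
elim: n => [|n IHn]; first by rewrite homogeneous1 mul0r.
have gxn : generated [set x] (x ^+ n)%g by move=> K Kx; apply/gpredXn/Kx.
by rewrite expgS (hf gx gxn) IHn -natr1 mulrDl mul1r addrC.
Qed.

Lemma homogeneousV x : f (x^-1)%g = - f x.
Proof.
have gx : generated [set x] x by move=> K; apply.
have gxV : generated [set x] (x^-1)%g by move=> K Kx; rewrite gpredV; apply: Kx.
by apply/eqP; rewrite -addr_eq0 addrC -(hf gx gxV) mulgV homogeneous1.
Qed.

End Homogeneous.

(** * Quasimorphisms with prescribed values from homomorphisms on sequences *)

Section Extension.
Variables (R : realType) (G : groupType) (N : groupClosed G).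
Hypothesis N_normal : is_normal N.
Variables (c : R) (I : group_seq (subgroup_of N) -> R -> Prop).

(* [I w t] prescribes the value [t] for the homomorphism on sequences at [w]. *)
Record slope_data : Prop := SlopeData {
  slope1 : I 1%g 0;
  slopeM : forall v w s t, I v s -> I w t -> I (v * w)%g (s + t);
  slopeV : forall w t, I w t -> I (w^-1)%g (- t);
  slope_le : forall w t q M, I w t ->
    (forall n, exists2 k, is_mixed_product N (val (w n)) k &
                          c * k%:R <= n%:R * q + M) -> t <= q }.

Hypothesis I_slope : slope_data.

(** Roughly, the sublinear function is the infimum, over the prescribed pairs (w, t), of t plus c
    times the growth rate of the length of z_n w_n^-1. Errors bounded in [n] are absorbed by [M]. *)
Let P : set (group_seq (subgroup_of N) * R) := [set zr | exists w t (M : R), I w t /\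
  forall n, exists2 k, is_mixed_product N (val (zr.1 n * (w n)^-1)%g) k &
                       c * k%:R <= n%:R * (zr.2 - t) + M].

Lemma slope_sublinear : sublinear P.
Proof.
split.
- exists 1%g, 0, 0; split=> [|n]; first exact: slope1.
  exists 0%N; last by rewrite mulr0 subrr mulr0 addr0.
  by rewrite mulgV val1; apply: mixed_product1.
- move=> x y r s [v [t [M [Iv xv]]]] [w [u [L [Iw yw]]]].
  exists (v * w)%g, (t + u), (M + L); split=> [|n /=]; first exact: slopeM.
  have [k /= xk ck] := xv n; have [l /= yl cl] := yw n.
  exists (k + l)%N; last by rewrite natrD; lra.
  have := mixed_productM xk (mixed_productJ N_normal (val (v n)) yl).
  by rewrite /= invgM !mulgA mulgVK.
(* Each term of a commutator of sequences is one commutator, so the growth rate is 0. *)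
- move=> x y; exists 1%g, 0, c; split=> [|n]; first exact: slope1.
  exists 1%N; last by rewrite mulr1 subr0 mulr0 add0r.
  rewrite /= invg1 mulg1.
  exact: mixed_product_comm (valP (y n)).
- move=> x r [w [t [M [Iw xw]]]]; exists (r - t - t), (w^-1)%g, (- t), M.
  split=> [|n /=]; first exact: slopeV.
  have [k /= xk ck] := xw n; exists k; last by lra.
  have := mixed_productJ N_normal (val (w n)^-1%g) (mixed_productV N_normal xk).
  by rewrite /= invgM !invgK !mulgA mulVg mul1g.
- move=> r [w [t [M [Iw xw]]]].
  (* At the identity the length bound concerns [w^-1], whose prescribed value is [- t]. *)
  suff : - t <= r - t by lra.
  apply: (slope_le I_slope (M := M)) (slopeV I_slope Iw) _ => n.
  by have [k xk ck] := xw n; exists k => //; rewrite /= mul1g in xk.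
Qed.

Lemma mixed_extension : exists mu : subgroup_of N -> R^o,
  [/\ mu \in @inv_homog_qm R G N,
      forall x y, `|mu (x * y)%g - mu x - mu y| <= c,
      forall x k, is_mixed_product N (val x) k -> `|mu x| <= c * k%:R
    & forall x t, I (powers x) t -> mu x = t].
Proof.
have [f [fM fP]] := dominated_hom slope_sublinear.
have f1 : f 1%g = 0 by apply: (addrI (f 1%g)); rewrite -fM mulg1 addr0.
have fV z : f (z^-1)%g = - f z.
  by apply/eqP; rewrite -addr_eq0 addrC -fM mulgV f1.
(* Lengths are invariant under inversion, so domination bounds [f] from both sides. *)
have f_le z r M : (forall n, exists2 k, is_mixed_product N (val (z n)) k &
    c * k%:R <= n%:R * r + M) -> `|f z| <= r.
  move=> zr; rewrite ler_norml lerNl -fV; apply/andP; split; apply: fP.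
    exists 1%g, 0, M; split=> [|n /=]; first exact: slope1.
    have [k zk ck] := zr n; exists k; last by rewrite subr0.
    by rewrite /= invg1 mulg1; apply: mixed_productV.
  exists 1%g, 0, M; split=> [|n /=]; first exact: slope1.
  have [k zk ck] := zr n; exists k; last by rewrite subr0.
  by rewrite /= invg1 mulg1.
exists (fun x => f (powers x)).
have qm x y : `|f (powers (x * y)%g) - f (powers x) - f (powers y)| <= c.
  rewrite addrAC -!fV -!fM; apply: (f_le _ _ 0) => n.
  exists n; last by rewrite addr0 mulrC.
  rewrite !gmulfM !gmulfV !gmulfXn gmulfM.
  by apply: mixed_product_expgM => //; apply: valP.
split=> //.
- apply/andP; split; apply/asboolP.
    split; first by apply/quasimorphismP; exists c.
    by apply: commute_homogeneous => x y xy; rewrite powersM.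
  move=> g x Ngx; apply/eqP; rewrite -subr_eq0 -normr_le0 -fV -fM.
  apply: (f_le _ _ c) => n; exists 1%N; last by rewrite mulr1 mulr0 add0r.
  rewrite gmulfM gmulfV !gmulfXn /= expg_conj.
  by apply: mixed_product_comm; apply/gpredXn/(valP x).
- move=> x k xk; apply: (f_le _ _ 0) => n; exists (n * k)%N.
    by rewrite gmulfXn; apply: mixed_productX.
  by rewrite natrM addr0 mulrCA.
(* A prescribed sequence is compared with itself, at length 0; its inverse gives the other
   inequality. *)
- move=> x t It; apply: le_anti; apply/andP; split.
    apply: fP; exists (powers x), t, 0; split=> // n; exists 0%N.
      by rewrite mulgV val1; apply: mixed_product1.
    by rewrite mulr0 subrr mulr0 addr0.
  rewrite -[leRHS]opprK lerNr -fV; apply: fP.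
  exists ((powers x)^-1)%g, (- t), 0; split=> [|n]; first exact: slopeV.
  exists 0%N; first by rewrite mulgV val1; apply: mixed_product1.
  by rewrite mulr0 subrr mulr0 addr0.
Qed.

End Extension.

(** * Conjugation invariance and bounds on commutators for homogeneous quasimorphisms *)

Lemma natmul_le (R : realType) (a b M : R) :
  (forall n : nat, n%:R * a <= n%:R * b + M) -> a <= b.
Proof.
move=> abM; rewrite leNgt; apply/negP => ba.
have ab0 : 0 < a - b by rewrite subr_gt0.
have := archi_boundP (divr_ge0 (normr_ge0 M) (ltW ab0)).
rewrite ltr_pdivrMr // => lt; have := abM (Num.bound (`|M| / (a - b))).
have := ler_norm M; lra.
Qed.

(** The values at g x^n g^-1 and x^n differ by at most twice the defect, uniformly in n; homogeneity
    divides this by n. *)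
Lemma homog_qm_conj (R : realType) (T : groupType) (f : T -> R^o) g x :
  f \in @homog_qm R T -> f (g * x * g^-1)%g = f x.
Proof.
move=> /asboolP[/quasimorphismP[D fD] hf].
apply/eqP; rewrite -subr_eq0 -normr_le0; apply: (@natmul_le _ _ _ (D + D)) => n.
rewrite mulr0 add0r -[n%:R]ger0_norm // -normrM mulrBr -!homogeneousX //.
rewrite expg_conj.
have := fD (g * x ^+ n)%g g^-1%g; have := fD g (x ^+ n)%g.
rewrite (homogeneousV hf) !ler_norml => /andP[? ?] /andP[? ?].
by apply/andP; split; lra.
Qed.

(** A mixed commutator is a conjugate of some [u] times [u^-1], so [mu] is at most [D] on it;
    multiplying it to the remaining product costs another [D]. *)
Lemma inv_homog_qm_bound (R : realType) (G : groupType) (N : groupClosed G)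
    (N_normal : is_normal N) (mu : subgroup_of N -> R^o) (D : R) x k :
    mu \in @inv_homog_qm R G N ->
    (forall y z, `|mu (y * z)%g - mu y - mu z| <= D) ->
  is_mixed_product N (val x) k -> `|mu x| <= 2 * D * k%:R.
Proof.
move=> /andP[/asboolP[_ hmu] /asboolP imu] muD [s [<- cs xs]].
elim: s x cs xs => [|z s IHs] x cs.
  rewrite big_nil => xs; rewrite (_ : x = 1%g); last exact: val_inj.
  by rewrite homogeneous1 // normr0 mulr0.
rewrite big_cons => xs; have [|g [a [Na za]]] := cs z; first by rewrite inE eqxx.
pose u : subgroup_of N := exist _ a Na.
pose v : subgroup_of N := exist _ (g * a * g^-1)%g (N_normal g a Na).
pose c := (v * u^-1)%g.
have -> : x = (c * (c^-1 * x))%g by rewrite mulgA mulgV mul1g.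
have IH : `|mu (c^-1 * x)%g| <= 2 * D * (size s)%:R.
  apply: IHs => [t ts|]; first by apply: cs; rewrite inE ts orbT.
  rewrite /= -/(val x) xs za /=.
  by rewrite mulgA mulVg mul1g.
have cD : `|mu c| <= D.
  have := muD v u^-1%g; rewrite (homogeneousV hmu) opprK.
  by rewrite (imu g u (N_normal g a Na)) subrK.
have := muD c (c^-1 * x)%g; rewrite /= -natr1 !ler_norml in cD IH *.
by move: cD IH => /andP[? ?] /andP[? ?] /andP[? ?]; apply/andP; split; lra.
Qed.

(** * Stable mixed commutator length *)

Section StableLength.
Variables (R : realType) (G : groupType) (N : groupClosed G).
Hypothesis N_normal : is_normal N.
Implicit Types (y : G) (k n : nat).

Lemma mixed_comm_subgroupP y :
  mixed_comm_subgroup N y <-> exists k, is_mixed_product N y k.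
Proof.
split=> [|[k [s [_ cs ->]]] K NK]; last first.
  by rewrite big_seq gpred_prod // => z /cs/NK.
pose S : {pred G} := fun z => `[< exists k, is_mixed_product N z k >].
have SP z : reflect (exists k, is_mixed_product N z k) (z \in S) by exact: asboolP.
have S1 : 1%g \in S by apply/SP; exists 0%N; apply: mixed_product1.
have SM : mulg_closed S.
  move=> a b /SP[k ak] /SP[l bl]; apply/SP; exists (k + l)%N.
  exact: mixed_productM.
have SV : invg_closed S.
  by move=> a /SP[k ak]; apply/SP; exists k; apply: mixed_productV.
pose K : groupClosed G := HB.pack S (isMulClosed.Build _ S SM)
  (isMul1Closed.Build _ S S1) (isInvClosed.Build _ S SV).
move=> /(_ K) Ky; apply/SP; apply: Ky => z [g [x [Nx ->]]].
by apply/SP; exists 1%N; apply: mixed_product_comm.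
Qed.

Lemma mixed_clP y k : is_mixed_product N y k ->
  is_mixed_product N y (mixed_cl N y) /\ (mixed_cl N y <= k)%N.
Proof.
move=> yk; rewrite /mixed_cl; case: xgetP => [n _ [yn nmin]|none].
  by split=> //; apply: nmin.
(* A least length exists, so [xget] does not fall back on its default. *)
have ex : exists n, `[< is_mixed_product N y n >] by exists k; apply/asboolP.
case: (ex_minnP ex) => m /asboolP ym mmin; case: (none m).
by split=> // n yn; apply/mmin/asboolP.
Qed.

(** The limit is the infimum of [u n / n] over positive [n], hence the largest slope below [u]. *)
Lemma fekete (u : nat -> R) : (forall n, 0 <= u n) ->
    (forall m n, u (m + n)%N <= u m + u n) ->
  exists2 l : R, (fun n => u n / n%:R : R) @ \oo --> l &
  (forall n, n%:R * l <= u n) /\ forall s, (forall n, n%:R * s <= u n) -> s <= l.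
Proof.
move=> u0 uD.
have uX k q : u (q * k)%N <= u 0%N + q%:R * u k.
  elim: q => [|q IHq]; first by rewrite mul0r addr0.
  by rewrite mulSn -natr1 mulrDl mul1r; have := uD k (q * k)%N; lra.
pose E := [set x | exists2 n, (0 < n)%N & x = u n / n%:R].
have E0 : E !=set0 by exists (u 1%N / 1), 1%N.
have Elb : lbound E 0 by move=> _ [n n0 ->]; apply: divr_ge0.
have hasE : has_inf E by split=> //; exists 0.
have infE n : n%:R * inf E <= u n.
  case: n => [|n]; first by rewrite mul0r.
  rewrite mulrC -ler_pdivlMr ?ltr0n //; apply: ge_inf; first exact: hasE.2.
  by exists n.+1.
exists (inf E); last first.
  split=> // s su; apply: lb_le_inf => // _ [n n0 ->].
  by rewrite ler_pdivlMr ?ltr0n // mulrC.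
apply/cvgrPdist_le => e e0.
have [_ [k k0 ->] ke] := inf_adherent (divr_gt0 e0 (ltr0n R 2)) hasE.
(* Write n = q k + r with r < k: each of the two applications of [uX] costs one [u 0], and the
   remainder costs at most k times [u 1]. *)
pose B := u 0%N + u 0%N + k%:R * u 1%N.
have B0 : 0 <= B by rewrite !addr_ge0 ?mulr_ge0.
have uB n : u n <= n%:R * (u k / k%:R) + B.
  rewrite {1}(divn_eq n k); have r := uD (n %/ k * k)%N (n %% k)%N.
  have := uX k (n %/ k)%N; have := uX 1%N (n %% k)%N; rewrite muln1 => r1 r2.
  have r3 : (n %% k)%:R * u 1%N <= k%:R * u 1%N.
    by rewrite ler_wpM2r // ler_nat ltnW // ltn_mod.
  have r4 : (n %/ k)%:R * u k <= n%:R * (u k / k%:R).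
    rewrite mulrCA [leLHS]mulrC ler_wpM2l // ler_pdivlMr ?ltr0n // -natrM ler_nat.
    exact: leq_divM.
  rewrite /B; lra.
near=> n.
have n0 : (0 < n)%N by near: n; exact: nbhs_infty_gt.
have nB : B <= n%:R * (e / 2).
  near: n; exists (Num.bound (B / (e / 2))) => // n /= nb.
  rewrite -ler_pdivrMr ?divr_gt0 //; apply: ltW.
  apply: lt_le_trans (archi_boundP _) _; first by rewrite divr_ge0 // ltW // divr_gt0.
  by rewrite ler_nat.
have n0' : 0 < n%:R :> R by rewrite ltr0n.
rewrite distrC ger0_norm; last first.
  by rewrite subr_ge0 ler_pdivlMr // mulrC.
rewrite lerBlDl ler_pdivrMr // mulrC.
have := uB n; have : n%:R * (u k / k%:R) <= n%:R * (inf E + e / 2).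
  by rewrite ler_pM2l // ltW.
lra.
Unshelve. all: by end_near. Qed.

(** This characterizes the stable length as a greatest lower slope, so that limits can be avoided
    from here on. *)
Lemma mixed_sclP y k : is_mixed_product N y k ->
  (forall n l, is_mixed_product N (y ^+ n)%g l -> n%:R * mixed_scl R N y <= l%:R) /\
  forall s : R, (forall n l, is_mixed_product N (y ^+ n)%g l -> n%:R * s <= l%:R) ->
    s <= mixed_scl R N y.
Proof.
move=> yk; have yX n := mixed_productX n yk.
have clX n : is_mixed_product N (y ^+ n)%g (mixed_cl N (y ^+ n)%g).
  by case: (mixed_clP (yX n)).
have [||l /cvg_lim ul [ln lmax]] := @fekete (fun n => (mixed_cl N (y ^+ n)%g)%:R).
- by [].
- move=> m n; rewrite -natrD ler_nat expgnDr.
  by case: (mixed_clP (mixed_productM (clX m) (clX n))).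
rewrite /mixed_scl ul //; split=> [n m ym|s sn]; last by apply: lmax => n; apply: sn.
by apply: (le_trans (ln n)); rewrite ler_nat; case: (mixed_clP ym).
Qed.

Lemma mixed_scl_ge0 y k : is_mixed_product N y k -> 0 <= mixed_scl R N y.
Proof. by move=> /mixed_sclP[_]; apply=> n l _; rewrite mulr0. Qed.

Lemma mixed_scl_le y k : is_mixed_product N y k -> mixed_scl R N y <= k%:R.
Proof.
by move=> yk; have [/(_ 1%N k) + _] := mixed_sclP yk; rewrite mul1r expg1; apply.
Qed.

Lemma homogeneous_le_scl (mu : subgroup_of N -> R^o) (c : R) x k :
    homogeneous mu -> 0 <= c ->
    (forall z l, is_mixed_product N (val z) l -> `|mu z| <= c * l%:R) ->
  is_mixed_product N (val x) k -> `|mu x| <= c * mixed_scl R N (val x).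
Proof.
move=> hmu; rewrite le0r => /orP[/eqP ->|c0] muc xk.
  by have := muc x k xk; rewrite !mul0r.
rewrite mulrC -ler_pdivrMr //; apply: (mixed_sclP xk).2 => n l xl.
rewrite mulrA ler_pdivrMr // [leRHS]mulrC -[n%:R]ger0_norm // -normrM.
by rewrite -(homogeneousX hmu); apply: muc; rewrite gmulfXn.
Qed.

End StableLength.

(** * The pair (G, G), and the easy half of Bavard duality *)

(** A named copy of the predicate in [scl], which can carry a subgroup structure and so makes the
    results on pairs (G, N) available for [scl]. *)
Definition full_group (G : groupType) : {pred G} := fun=> true.
Arguments full_group : clear implicits.

Section FullGroup.
Variables (R : realType) (G : groupType).

Lemma full_groupM : mulg_closed (full_group G). Proof. by []. Qed.
Lemma full_group1 : 1%g \in full_group G. Proof. by []. Qed.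
Lemma full_groupV : invg_closed (full_group G). Proof. by []. Qed.

HB.instance Definition _ := isMulClosed.Build G (full_group G) full_groupM.
HB.instance Definition _ := isMul1Closed.Build G (full_group G) full_group1.
HB.instance Definition _ := isInvClosed.Build G (full_group G) full_groupV.

Lemma full_group_normal : is_normal (full_group G). Proof. by []. Qed.

Lemma mixed_product_full (N : groupClosed G) y k :
  is_mixed_product N y k -> is_mixed_product (full_group G) y k.
Proof.
move=> [s [sk cs ->]]; exists s; split=> // z /cs[g [x [_ ->]]].
by exists g, x.
Qed.

End FullGroup.

(** Commuting elements need not lie in a common cyclic subgroup. Instead, (x y)^n = x^n y^n, and the
    defect is divided by n. *)
Lemma homog_qm_commute (R : realType) (T : groupType) (f : T -> R^o) x y :
  f \in @homog_qm R T -> commute x y -> f (x * y)%g = f x + f y.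
Proof.
move=> /asboolP[/quasimorphismP[D fD] hf] xy.
apply/eqP; rewrite -subr_eq0 -normr_le0; apply: (@natmul_le _ _ _ D) => n.
rewrite mulr0 add0r -[n%:R]ger0_norm // -normrM opprD addrA !mulrBr.
by rewrite -!homogeneousX // expgMn.
Qed.

Section EasyBavard.
Variables (R : realType) (G : groupType).

Lemma inv_homog_qm_le_scl (N : groupClosed G) (mu : subgroup_of N -> R^o) :
    is_normal N -> mu \in @inv_homog_qm R G N ->
  exists2 D, 0 <= D & forall x k, is_mixed_product N (val x) k ->
    `|mu x| <= D * mixed_scl R N (val x).
Proof.
move=> N_normal muI; have /andP[/asboolP[/quasimorphismP[D muD] hmu] _] := muI.
have D0 : 0 <= D by apply: le_trans (muD 1%g 1%g).
exists (2 * D) => [|x k]; first by rewrite mulr_ge0.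
apply: homogeneous_le_scl => //; first by rewrite mulr_ge0.
by move=> z l; apply: inv_homog_qm_bound.
Qed.

Lemma restrict_homog_qm (N : groupClosed G) (phi : G -> R^o) :
    phi \in @homog_qm R G ->
  (fun x : subgroup_of N => phi (val x)) \in @inv_homog_qm R G N.
Proof.
move=> phiQ; have /asboolP[/quasimorphismP[D phiD] hphi] := phiQ.
apply/andP; split; apply/asboolP; last first.
  by move=> g x Ngx; apply: homog_qm_conj.
split; first by apply/quasimorphismP; exists D => x y; apply: phiD.
apply: commute_homogeneous => x y xy.
by apply: homog_qm_commute => //; apply: (gmulf_commute val xy).
Qed.

Lemma homog_qm_le_scl (phi : G -> R^o) : phi \in @homog_qm R G ->
  exists2 D, 0 <= D & forall y k, is_mixed_product (full_group G) y k ->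
    `|phi y| <= D * scl R y.
Proof.
move=> /(restrict_homog_qm (full_group G)) phiI.
have [D D0 phiD] := inv_homog_qm_le_scl (@full_group_normal G) phiI.
by exists D => // y k yk; apply: (phiD (exist _ y isT) k).
Qed.

End EasyBavard.

Lemma submod_quot_eq0 (K : pzRingType) (V : lmodType K) (U : zmodClosed V)
    (U_scale : scaler_closed U) :
  (forall w : submod_quot U_scale, w = 0) <-> (forall v, v \in U).
Proof.
have pi0 : \pi_(submod_quot U_scale)%qT 0 = 0 by exact: raddf0.
have piE v : (\pi_(submod_quot U_scale) v == 0)%qT = (v \in U).
  by have := Quotient.idealrBE U v 0; rewrite subr0 => ->; rewrite -pi0.
split=> [w0 v|UV w]; first by have /eqP := w0 (\pi_(submod_quot U_scale)%qT v); rewrite piE.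
by apply/eqP; rewrite -[w]reprK piE.
Qed.

(** * From bi-Lipschitz equivalence to the vanishing of W(G, N) *)

Section Converse.
Variables (R : realType) (G : groupType) (N : groupClosed G).
Hypothesis N_normal : is_normal N.

(** Since [nu] kills (x y)^n y^-n x^-n, the numbers [nu] of (x y)^n and of x^n y^n differ by a
    bounded amount; divide by n. *)
Lemma hom_of_vanishing (nu : subgroup_of N -> R^o) :
    nu \in @inv_homog_qm R G N ->
    (forall x k, is_mixed_product N (val x) k -> nu x = 0) ->
  nu \in @real_hom R (subgroup_of N).
Proof.
move=> /andP[/asboolP[/quasimorphismP[D nuD] hnu] _] nu0.
apply/asboolP => x y; apply/eqP; rewrite -subr_eq0 -normr_le0.
apply: (@natmul_le _ _ _ (D + D)) => n.
rewrite mulr0 add0r -[n%:R]ger0_norm // -normrM opprD addrA !mulrBr.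
rewrite -!homogeneousX //.
have := nuD ((x * y) ^+ n * y ^- n * x ^- n)%g (x ^+ n * y ^+ n)%g.
have -> : nu ((x * y) ^+ n * y ^- n * x ^- n)%g = 0.
  apply: (nu0 _ n); rewrite !(gmulfM, gmulfV, gmulfXn).
  by apply: mixed_product_expgM => //; apply: valP.
rewrite !mulgA !mulgVK subr0; have := nuD (x ^+ n)%g (y ^+ n)%g.
rewrite !ler_norml => /andP[? ?] /andP[? ?].
by apply/andP; split; lra.
Qed.

Variables (C : R) (mu : subgroup_of N -> R^o).
Hypothesis C_ge1 : 1 <= C.
Hypothesis bilip : forall y : G, mixed_comm_subgroup N y ->
  mixed_scl R N y <= C * scl R y.
Hypothesis muI : mu \in @inv_homog_qm R G N.

Lemma bilipschitz_extension : exists2 phi : G -> R^o, phi \in @homog_qm R G &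
  forall x k, is_mixed_product N (val x) k -> phi (val x) = mu x.
Proof.
have [D D0 muD] := inv_homog_qm_le_scl N_normal muI.
have /andP[/asboolP[/quasimorphismP[E muE] hmu] _] := muI.
(* The prescribed sequences run in [G, N], and [t] is the slope of [mu] along them. *)
pose I (w : group_seq (subgroup_of (full_group G))) (t : R) :=
  exists (v : group_seq (subgroup_of N)) (M : R), forall n,
  [/\ val (w n) = val (v n), exists k, is_mixed_product N (val (v n)) k
    & `|mu (v n) - n%:R * t| <= M].
have [||psi [psiI psiD _ psimu]] := @mixed_extension R G (full_group G) _ (D * C) I.
- exact: full_group_normal.
- split.
  + exists 1%g, 0 => n; split=> //; first by exists 0%N; apply: mixed_product1.
    by rewrite homogeneous1 // mulr0 subrr normr0.
  + move=> w1 w2 s t [v1 [M1 v1P]] [v2 [M2 v2P]].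
    exists (v1 * v2)%g, (M1 + M2 + E) => n.
    have [e1 [k1 p1] m1] := v1P n; have [e2 [k2 p2] m2] := v2P n.
    split; first by rewrite /= -/(val _) e1 e2.
      by exists (k1 + k2)%N; apply: mixed_productM.
    have := muE (v1 n) (v2 n); rewrite !ler_norml in m1 m2 *.
    by move: m1 m2 => /andP[? ?] /andP[? ?] /andP[? ?]; apply/andP; split; lra.
  + move=> w t [v [M vP]]; exists (v^-1)%g, M => n; have [e [k p] m] := vP n.
    split; first by rewrite /= e.
      by exists k; apply: mixed_productV.
    by rewrite group_seqV homogeneousV // mulrN -opprD normrN.
  + move=> w t q M [v [L vP]] wM; apply: (@natmul_le _ _ _ (L + M)) => n.
    have [e [k p] m] := vP n; have [l wl cl] := wM n.
    have wN : mixed_comm_subgroup N (val (v n)).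
      by apply/mixed_comm_subgroupP => //; exists k.
    (* The chain is |mu| <= D scl_{G,N} <= D C scl_G <= D C cl_G, which is where the constant
       [D * C] comes from. *)
    have h1 := muD _ _ p; have h2 := bilip wN.
    have h3 : scl R (val (v n)) <= l%:R by rewrite -e; apply: mixed_scl_le wl.
    have h4 : `|mu (v n)| <= D * C * l%:R.
      apply: (le_trans h1); rewrite -mulrA ler_wpM2l //; apply: (le_trans h2).
      by rewrite ler_wpM2l // (le_trans ler01).
    rewrite !ler_norml in m h4; move: m h4 => /andP[? ?] /andP[? ?]; lra.
pose i y : subgroup_of (full_group G) := exist _ y isT.
have iM x y : i (x * y)%g = (i x * i y)%g by apply: val_inj.
exists (fun y => psi (i y)).
  apply/asboolP; split.
    by apply/quasimorphismP; exists (D * C) => x y; rewrite iM.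
  apply: commute_homogeneous => x y xy.
  have /andP[psiQ _] := psiI.
  by rewrite iM; apply: homog_qm_commute => //; rewrite /commute -!iM xy.
move=> x k xk; apply: psimu; exists (powers x), 0 => n.
split; first by rewrite !gmulfXn.
  by exists (n * k)%N; rewrite gmulfXn; apply: mixed_productX.
by rewrite homogeneousX // subrr normr0.
Qed.

Lemma bilipschitz_trivial : exists nu phi, [/\ nu \in @inv_homog_qm R G N,
  nu \in @real_hom R (subgroup_of N), phi \in @homog_qm R G &
  forall x, mu x = nu x + phi (val x)].
Proof.
have [phi phiQ phimu] := bilipschitz_extension.
pose res (x : subgroup_of N) : R^o := phi (val x).
have nuI : mu - res \in @inv_homog_qm R G N.
  by rewrite rpredB // restrict_homog_qm.
exists (mu - res), phi; split=> // [|x].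
  apply: hom_of_vanishing => // x k xk.
  by rewrite addrfctE opprfctE /res (phimu x k xk) subrr.
by rewrite addrfctE opprfctE /= subrK.
Qed.

End Converse.

(** * Sharp Bavard duality and the gliding hump *)

Section GlidingHump.
Variables (R : realType) (G : groupType) (N : groupClosed G).
Hypothesis N_normal : is_normal N.

(** The value [s] is prescribed on the sequence of powers of [x], with length constant 1.
    Compatibility is the lower bound on the lengths of powers of [x] from [mixed_sclP]; for i < j
    the prescribed slope is at most 0. *)
Lemma bavard_attained (x : subgroup_of N) k : is_mixed_product N (val x) k ->
  exists mu : subgroup_of N -> R^o,
  [/\ mu \in @inv_homog_qm R G N,
      forall y z, `|mu (y * z)%g - mu y - mu z| <= 1,
      forall z l, is_mixed_product N (val z) l -> `|mu z| <= l%:R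
    & mu x = mixed_scl R N (val x)].
Proof.
move=> xk; set s := mixed_scl R N (val x).
have [s0 [sX _]] := (mixed_scl_ge0 R xk, mixed_sclP R xk).
pose I (w : group_seq (subgroup_of N)) (t : R) := exists i j,
  w = powers (x ^+ i * x ^- j)%g /\ t = (i%:R - j%:R) * s.
have xx m n : commute (x ^+ m)%g (x ^+ n)%g.
  exact/commuteX2/commute_refl.
have xV m n : commute (x ^+ m)%g (x ^- n)%g by apply: commuteV.
have VV m n : commute (x ^- m)%g (x ^- n)%g.
  by apply/commuteV/commute_sym/xV.
have cX i j l m : commute (x ^+ i * x ^- j)%g (x ^+ l * x ^- m)%g.
  by apply: commuteM; apply: commute_sym; apply: commuteM => //;
    apply: commute_sym.
have [|mu [muI muD mul muP]] := @mixed_extension R G N N_normal 1 I.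
- split.
  + exists 0%N, 0%N; rewrite !expg0 mulgV subrr mul0r; split=> //.
    by apply/funext => n; rewrite /powers expg1n.
  + move=> v w t u [i [j [-> ->]]] [k' [l [-> ->]]].
    exists (i + k')%N, (j + l)%N; split; last by rewrite !natrD; ring.
    rewrite -powersM //; congr powers.
    rewrite expgnDr addnC expgnDr invgM !mulgA; congr (_ * _)%g.
    by rewrite -!mulgA xV.
  + move=> w t [i [j [-> ->]]]; exists j, i; split; last by ring.
    by apply/funext => n; rewrite group_seqV /powers -expVgn invgF.
  + move=> w t q M [i [j [-> ->]]] wq.
    apply: (@natmul_le _ _ _ M) => n; have [l wl] := wq n; rewrite mul1r.
    apply: le_trans; have [ji|/ltnW ij] := leqP j i.
      have := sX ((i - j) * n)%N l; rewrite natrM natrB // => h.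
      rewrite mulrA [n%:R * _]mulrC; apply: h.
      by move: wl; rewrite /powers -expgnFr // -expgnA gmulfXn.
    apply: le_trans (ler0n R l); rewrite mulrCA -oppr_ge0 -mulNr opprB.
    by rewrite mulr_ge0 ?subr_ge0 ?ler_nat // mulr_ge0.
exists mu; split=> //.
- by move=> z l zl; rewrite -[l%:R]mul1r; apply: mul.
- apply: muP; exists 1%N, 0%N; split; last by rewrite subr0 mul1r.
  by rewrite expg0 invg1 mulg1 expg1.
Qed.

Variables (x_ : nat -> subgroup_of N) (mu_ : nat -> subgroup_of N -> R^o).
Hypothesis muI : forall n, mu_ n \in @inv_homog_qm R G N.
Hypothesis muD : forall n y z, `|mu_ n (y * z)%g - mu_ n y - mu_ n z| <= 1.
Hypothesis mu_le : forall n z l, is_mixed_product N (val z) l -> `|mu_ n z| <= l%:R.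

Let third : R := 3^-1.
(** The sum of 3^-j over j >= n. *)
Let tail n : R := 3 / 2 * third ^+ n.

(* The sign makes the [n]-th term reinforce the previous partial sum at
   [x_ n]. *)
Fixpoint hump n : subgroup_of N -> R :=
  if n is m.+1 then fun z => hump m z +
    (if (0 <= hump m (x_ m)) == (0 <= mu_ m (x_ m)) then 1 else -1) * third ^+ m * mu_ m z
  else fun=> 0.

Let sgn n : R := if (0 <= hump n (x_ n)) == (0 <= mu_ n (x_ n)) then 1 else -1.

Lemma humpS n z : hump n.+1 z = hump n z + sgn n * third ^+ n * mu_ n z.
Proof. by []. Qed.

Lemma third_gt0 n : 0 < third ^+ n.
Proof. by rewrite exprn_gt0 // invr_gt0 ltr0n. Qed.

Lemma norm_sgn n a : `|sgn n * third ^+ n * a| = third ^+ n * `|a|.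
Proof.
rewrite !normrM (ger0_norm (ltW (third_gt0 n))) /sgn.
by case: ifP; rewrite ?normrN normr1 mul1r.
Qed.

Lemma tailS n : tail n.+1 = tail n - third ^+ n.
Proof. by rewrite /tail exprS /third; field. Qed.

Lemma tail_gt0 n : 0 < tail n.
Proof. by rewrite mulr_gt0 ?third_gt0 // divr_gt0 ?ltr0n. Qed.

Lemma hump_dist z b m n : (forall j, `|mu_ j z| <= b) -> (n <= m)%N ->
  `|hump m z - hump n z| <= (tail n - tail m) * b.
Proof.
move=> zb; elim: m => [|m IHm].
  by rewrite leqn0 => /eqP ->; rewrite !subrr normr0 mul0r.
rewrite leq_eqVlt ltnS => /predU1P[->|/IHm {}IHm].
  by rewrite !subrr normr0 mul0r.
rewrite humpS addrAC; apply: (le_trans (ler_normD _ _)).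
rewrite norm_sgn tailS.
have := ler_wpM2l (ltW (third_gt0 m)) (zb m); lra.
Qed.

Lemma hump_qm y z n : `|hump n (y * z)%g - hump n y - hump n z| <= 3 / 2.
Proof.
suff : `|hump n (y * z)%g - hump n y - hump n z| <= 3 / 2 - tail n.
  by move/le_trans; apply; rewrite gerBl ltW // tail_gt0.
elim: n => [|n IHn]; first by rewrite /= !subrr normr0 /tail expr0 mulr1 subrr.
rewrite !humpS tailS.
rewrite [X in `|X|](_ : _ = (hump n (y * z)%g - hump n y - hump n z) +
  sgn n * third ^+ n * (mu_ n (y * z)%g - mu_ n y - mu_ n z)); last by ring.
apply: (le_trans (ler_normD _ _)); rewrite norm_sgn.
have := ler_wpM2l (ltW (third_gt0 n)) (muD n y z); lra.
Qed.

Lemma hump_homogeneous n : homogeneous (hump n : subgroup_of N -> R^o).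
Proof.
move=> h y z hy hz; elim: n => [|n IHn]; first by rewrite /= addr0.
have /andP[/asboolP[_ hmu] _] := muI n.
by rewrite !humpS IHn (hmu h) // mulrDr addrACA.
Qed.

Lemma hump_large n :
  third ^+ n * `|mu_ n (x_ n)| <= `|hump n.+1 (x_ n)|.
Proof.
rewrite humpS /sgn; set a := hump n _; set b := mu_ n _.
rewrite -(pmulr_rge0 b (third_gt0 n)) -mulrA.
rewrite -{1}(ger0_norm (ltW (third_gt0 n))) -normrM.
set c := _ * b; case: (lerP 0 a) => a0; case: (lerP 0 c) => c0 /=.
- by rewrite !ger0_norm; lra.
- by rewrite ltr0_norm // ger0_norm; lra.
- by rewrite ger0_norm // ltr0_norm; lra.
- by rewrite !ltr0_norm; lra.
Qed.

(** The intervals of radius [tail n * b] around [hump n z] meet pairwise, so the supremum of their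
    left endpoints lies in all of them. *)
Lemma hump_limit z b : (forall j, `|mu_ j z| <= b) ->
  exists t, forall n, `|hump n z - t| <= tail n * b.
Proof.
move=> zb; have b0 : 0 <= b by apply: le_trans (zb 0%N).
have tb n : 0 <= tail n * b by rewrite mulr_ge0 // ltW // tail_gt0.
have le_nm m n : hump n z - tail n * b <= hump m z + tail m * b.
  have [nm|/ltnW mn] := leqP n m.
    have := hump_dist zb nm; rewrite ler_norml => /andP[? ?].
    have := tb m; lra.
  have := hump_dist zb mn; rewrite ler_norml => /andP[? ?].
  have := tb n; lra.
pose E := [set hump n z - tail n * b | n in setT].
have E0 : E !=set0 by exists (hump 0 z - tail 0 * b), 0%N.
have ubE m : ubound E (hump m z + tail m * b) by move=> _ [n _ <-].
exists (sup E) => n; rewrite ler_norml.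
have : sup E <= hump n z + tail n * b by apply: ge_sup.
have : hump n z - tail n * b <= sup E.
  by apply: ub_le_sup; [exists (hump 0 z + tail 0 * b) | exists n].
by move=> ? ?; apply/andP; split; lra.
Qed.

(** Off [G, N] the values [mu_ j z] may be unbounded in [j] and the series may diverge. So the
    partial sums are used diagonally: the [n]-th one is evaluated at the [n]-th term of a sequence,
    and its slope is prescribed. *)
Lemma hump_extension : exists2 mu : subgroup_of N -> R^o,
  mu \in @inv_homog_qm R G N &
  forall z b, (forall j, `|mu_ j z| <= b) -> forall n, `|hump n z - mu z| <= tail n * b.
Proof.
pose I (w : group_seq (subgroup_of N)) (t : R) := exists M : R, forall n,
  `|hump n (w n) - n%:R * t| <= M.
have [|mu [muQ _ _ muP]] := @mixed_extension R G N N_normal (3 / 2) I.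
- split.
  + exists 0 => n; rewrite (homogeneous1 (hump_homogeneous n)).
    by rewrite mulr0 subrr normr0.
  + move=> v w s t [M vM] [L wL]; exists (M + L + 3 / 2) => n.
    have := hump_qm (v n) (w n) n; move: (vM n) (wL n); rewrite !ler_norml.
    by move=> /andP[? ?] /andP[? ?] /andP[? ?]; apply/andP; split; lra.
  + move=> w t [M wM]; exists M => n.
    by rewrite (homogeneousV (hump_homogeneous n)) mulrN -opprD normrN.
  + move=> w t q M [L wL] wM; apply: (@natmul_le _ _ _ (L + M)) => n.
    have [l wl cl] := wM n.
    have := hump_dist (fun j => mu_le j wl) (leq0n n).
    rewrite /= subr0 {1}/tail expr0 mulr1 => hl.
    have tl : 0 <= tail n * l%:R by rewrite mulr_ge0 // ltW // tail_gt0.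
    move: (wL n) hl; rewrite !ler_norml => /andP[? ?] /andP[? ?]; lra.
exists mu => // z b zb; have [t zt] := hump_limit zb.
suff -> : mu z = t by [].
have b0 : 0 <= b by apply: le_trans (zb 0%N).
(* Along powers of [z] the error is at most [n * tail n * b], which stays bounded as n <= 3^n. *)
apply: muP; exists (3 / 2 * b) => n.
rewrite (homogeneousX (hump_homogeneous n)) -mulrBr normrM ger0_norm //.
apply: (le_trans (ler_wpM2l (ler0n R n) (zt n))).
rewrite mulrA ler_wpM2r // /tail mulrCA -[leRHS]mulr1 ler_wpM2l //.
rewrite /third exprVn ler_pdivrMr ?exprn_gt0 ?ltr0n // mul1r -natrX ler_nat.
exact/ltnW/ltn_expl.
Qed.

End GlidingHump.

(** * The equivalence *)

Section Theorem1.
Variables (R : realType) (G : groupType) (N : groupClosed G).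
Hypothesis N_normal : is_normal N.

Lemma trivial_qm_le_scl (mu : InvHomogQM R N) : mu \in @trivial_qm R G N ->
  exists D : R, forall x k, is_mixed_product N (val x) k ->
    `|val mu x| <= D * scl R (val x).
Proof.
move=> /asboolP[nu [rho [/asboolP hnu [phi rho_phi] ->]]].
have [D D0 phiD] := homog_qm_le_scl (valP phi).
exists D => x k xk; rewrite /= addrfctE.
have nu0 : val nu x = 0.
  (* A homomorphism has defect 0, so the commutator bound makes it vanish here. *)
  have := inv_homog_qm_bound (D := 0) N_normal (valP nu) _ xk.
  rewrite mulr0 mul0r normr_le0 => /(_ _)/eqP; apply => y z.
  by rewrite hnu -addrA -opprD subrr normr0.
rewrite nu0 add0r rho_phi; apply: (phiD _ k).
exact: mixed_product_full xk.
Qed.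

(** With a = scl_{G,N}(x_n), the hump at x_n is at least 3^-n a and the later terms take away at
    most half of it. As a > 9^n scl_G(x_n), what is left exceeds 3^n scl_G(x_n) / 2. *)
Lemma not_bilipschitz_sequence :
  (forall C : R, 1 <= C -> exists2 y, mixed_comm_subgroup N y &
     C * scl R y < mixed_scl R N y) ->
  exists2 mu, mu \in @inv_homog_qm R G N &
  forall D : R, exists x k, is_mixed_product N (val x) k /\
     D * scl R (val x) < `|mu x|.
Proof.
move=> unb.
have /choice[x_ x_P] n : exists x : subgroup_of N, exists2 k,
    is_mixed_product N (val x) k & 9 ^+ n * scl R (val x) < mixed_scl R N (val x).
  have [|y /mixed_comm_subgroupP -/(_ N_normal)[k yk] lt] := unb (9 ^+ n).
    by rewrite exprn_ege1 // ler1n.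
  by exists (exist _ y (mixed_product_in N_normal yk)), k.
have /choice[mu_ mu_P] n : exists mu : subgroup_of N -> R^o,
  [/\ mu \in @inv_homog_qm R G N,
      forall y z, `|mu (y * z)%g - mu y - mu z| <= 1,
      forall z l, is_mixed_product N (val z) l -> `|mu z| <= l%:R
    & mu (x_ n) = mixed_scl R N (val (x_ n))].
  by have [k xk _] := x_P n; apply: bavard_attained xk.
have muI n : mu_ n \in @inv_homog_qm R G N by case: (mu_P n).
have muD n y z : `|mu_ n (y * z)%g - mu_ n y - mu_ n z| <= 1 by case: (mu_P n).
have mu_le n z l : is_mixed_product N (val z) l -> `|mu_ n z| <= l%:R.
  by case: (mu_P n) => _ _ + _; apply.
have [mu muQ mu_hump] := hump_extension N_normal x_ muI muD mu_le.
exists mu => // D.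
(* This gives 2 |D| <= n <= 3^n. *)
pose n := Num.bound (2 * `|D|).
have [k xk lt] := x_P n; exists (x_ n), k; split=> //.
set a := mixed_scl R N (val (x_ n)) in lt *.
set b := scl R (val (x_ n)) in lt *.
have b0 : 0 <= b by apply: (mixed_scl_ge0 R (mixed_product_full xk)).
have mua j : `|mu_ j (x_ n)| <= a.
  have /andP[/asboolP[_ hmu] _] := muI j.
  rewrite -[leRHS]mul1r; apply: homogeneous_le_scl xk => //.
  by move=> z l zl; rewrite mul1r; apply: mu_le.
have := hump_large x_ mu_ n.
have -> : mu_ n (x_ n) = a by case: (mu_P n).
have a0 : 0 < a by apply: le_lt_trans lt; rewrite mulr_ge0 // exprn_ge0.
rewrite (gtr0_norm a0) => large.
have far := mu_hump _ _ mua n.+1.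
have far_le : `|hump x_ mu_ n.+1 (x_ n)| <= 3 / 2 * 3^-1 ^+ n.+1 * a + `|mu (x_ n)|.
  have := ler_normD (hump x_ mu_ n.+1 (x_ n) - mu (x_ n)) (mu (x_ n)).
  by rewrite subrK; lra.
have t0 : 0 < 3^-1 ^+ n :> R by rewrite exprn_gt0 // invr_gt0 ltr0n.
have nD : D * 2 * b <= 3 ^+ n * b.
  rewrite ler_wpM2r //; apply: (@le_trans _ _ n%:R); last first.
    by rewrite -natrX ler_nat; apply/ltnW/ltn_expl.
  have : 2 * `|D| <= n%:R by apply/ltW/archi_boundP; rewrite mulr_ge0.
  by have := ler_norm D; lra.
have small : 3 ^+ n * b < 3^-1 ^+ n * a.
  have := lt; rewrite -(ltr_pM2l t0) mulrA -exprMn.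
  by rewrite (_ : 3^-1 * 9 = 3) //; field.
move: far_le; rewrite exprS; lra.
Qed.

End Theorem1.

Unset Implicit Arguments.

Theorem theorem1 (R : realType) (G : groupType) (N : groupClosed G)
    (N_normal : is_normal N) :
  (exists C : R, 1 <= C /\
     forall y : G, mixed_comm_subgroup N y ->
       mixed_scl R N y <= C * scl R y)
  <-> (forall w : W R N, w = 0).
Proof.
rewrite submod_quot_eq0; split=> [[C [C1 bilip]] mu|triv].
  have [nu [phi [nuI nuH phiQ muE]]] := bilipschitz_trivial N_normal C1 bilip (valP mu).
  pose rho : InvHomogQM R N := Sub (fun x => phi (val x)) (restrict_homog_qm N phiQ).
  apply/asboolP; exists (Sub nu nuI), rho.
  split=> //; first by exists (exist _ phi phiQ).
  by apply/val_inj/funext.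
have [//|nbilip] := pselect (exists C : R, 1 <= C /\
  forall y : G, mixed_comm_subgroup N y -> mixed_scl R N y <= C * scl R y).
have [|mu muI mu_large] := not_bilipschitz_sequence N_normal (R := R).
  move=> C C1; apply: contrapT => none; apply: nbilip; exists C; split=> // y Ny.
  by rewrite leNgt; apply/negP => lt; apply: none; exists y.
have [D muD] := trivial_qm_le_scl N_normal (triv (exist _ mu muI)).
have [x [k [xk]]] := mu_large D.
by rewrite ltNge (muD x k xk).
Qed.
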